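(* The number $R_3(L)$ satisfies $R_3(L) \leq 1573$.
   Context: For a positive integer $n$, the $n \times n$ integer grid is $[n]\times[n]=\{(i,j): 1\le i,j\le n\}$, where $(i,j)$ is the point in row $i$ (rows counted downward) and column $j$ (columns counted left to right). Given a coloring of $[n]\times[n]$ with $k$ colors (an arbitrary map from $[n]\times[n]$ to a set of $k$ colors), a monochromatic $L$ is a set of three points $\{(x,y),(x+d,y),(x+d,y+d)\}\subseteq [n]\times[n]$, with $d$ a positive integer, all having the same color. For a positive integer $k$, $R_k(L)$ denotes the least positive integer $n$ such that every $k$-coloring of $[n]\times[n]$ contains a monochromatic $L$ (it exists by the Gallai-Witt theorem). *)

(* Defs.v *)
From mathcomp Require Import all_boot.
Set Implicit Arguments.
Unset Strict Implicit.
Unset Printing Implicit Defensive.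

(* The grid [n] x [n] is indexed from 0; (i, j) is the point in row i (counted
   downward) and column j (counted left to right). *)
Definition grid (n : nat) : finType := ('I_n * 'I_n)%type.

(* Taking the coordinates x + d and y + d in 'I_n makes S lie in the grid. *)
Definition is_L (n : nat) (S : {set grid n}) : Prop :=
  exists (d : nat) (x y xd yd : 'I_n),
    [/\ 0 < d, xd = x + d :> nat, yd = y + d :> nat
      & S = [set (x, y); (xd, y); (xd, yd)]].

Definition monochromatic (n k : nat) (c : {ffun grid n -> 'I_k})
    (S : {set grid n}) : Prop :=
  {in S &, forall p q, c p = c q}.

Definition forces_L (k n : nat) : Prop :=
  forall c : {ffun grid n -> 'I_k},
    exists2 S : {set grid n}, is_L S & monochromatic c S.

(* n = R_k(L). This is a relation rather than a function so that no junk value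
   is needed before the existence of R_k(L) is proved; there is at most one
   such n. *)
Definition is_RL (k n : nat) : Prop :=
  [/\ 0 < n, forces_L k n & forall m, 0 < m -> forces_L k m -> n <= m].

(* Main.v *)
(** Color 1 being a most frequent color on the main diagonal, let P be the set
    of the i such that (i, i) has color 1. No point (b, a) with a < b both in P
    has color 1, so for d > 0 the points (i + d, i) with i and i + d in P have
    only two colors. Let Q be the set of the i for which (i + d, i) has a given
    one of these, color 2. If a < b are in Q, then (b + d, a) has neither color
    1 nor color 2, hence color 3. If two pairs in Q had the same difference,
    i, i + e and j, j + e with i < j, then (j + d, i), (j + e + d, i),
    (j + e + d, i + e) would be an L of color 3. So the differences of Q, which
    lie between 1 and n - d - 1, are distinct, and #|Q| is of order
    (2 (n - d))^(1/2). Summing over the two colors and over d bounds 'C(#|P|, 2),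
    which contradicts #|P| >= n / 3 when n = 1573. *)
Require Import Defs.
From mathcomp Require Import all_boot.
From mathcomp Require Import zify.
From Stdlib Require Import Classical.

Set Implicit Arguments.
Unset Strict Implicit.
Unset Printing Implicit Defensive.

(** Both sides count the pairs [i < j < n] in [P]; the step from [n] to [n.+1] adds the pairs with
    larger element [n]. *)
Lemma sum_pairs_by_difference (P : pred nat) (n : nat) :
  \sum_(1 <= d < n) \sum_(0 <= i < n - d) (P i && P (i + d)) =
  'C(\sum_(0 <= i < n) P i, 2).
Proof.
elim: n => [|n IHn]; first by rewrite !big_geq.
case: n IHn => [|n] IHn; first by rewrite big_geq // big_nat1; case: (P 0).
rewrite [in RHS]big_nat_recr //=.
have -> : \sum_(1 <= d < n.+2) \sum_(0 <= i < n.+2 - d) (P i && P (i + d)) =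
    \sum_(1 <= d < n.+2)
      (\sum_(0 <= i < n.+1 - d) (P i && P (i + d)) + (P (n.+1 - d) && P n.+1)).
  apply: eq_big_nat => d /andP[d_gt0 d_lt].
  by rewrite (_ : n.+2 - d = (n.+1 - d).+1) ?big_nat_recr //= ?subnK //; lia.
rewrite big_split big_nat_recr // IHn subnn /= (@big_geq _ _ _ 0 0) // addn0.
have -> : \sum_(1 <= d < n.+2) (P (n.+1 - d) && P n.+1) =
    P n.+1 * \sum_(0 <= i < n.+1) P i.
  rewrite big_add1 /= [in RHS]big_nat_rev /= big_distrr /=.
  by apply: eq_bigr => i _; rewrite add0n subSS; case: (P n.+1); case: (P _).
by case: (P n.+1); rewrite ?addn0 // mul1n addn1 binS bin1.
Qed.

Lemma sum_pred_le1 (P : pred nat) (m : nat) :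
  (forall i j, i < j < m -> P i -> ~~ P j) -> \sum_(0 <= i < m) P i <= 1.
Proof.
elim: m => [|m IHm] uniqP; first by rewrite big_geq.
rewrite big_nat_recr //=.
case Pm: (P m); last first.
  by rewrite addn0; apply: IHm => i j ijm; apply: uniqP; lia.
rewrite big_nat_cond big1 // => i /andP[/andP[_ lt_im] _].
by case Pi: (P i) => //; have := uniqP i m; rewrite Pm Pi lt_im ltnSn => /(_ isT isT).
Qed.

Lemma sum_color_classes (T : finType) (P : pred nat) (g : nat -> T) (m : nat) :
  \sum_(0 <= i < m) P i = \sum_(c : T) \sum_(0 <= i < m) (P i && (g i == c)).
Proof.
rewrite exchange_big /=; apply: eq_bigr => i _.
rewrite (bigD1 (g i)) //= eqxx andbT big1 ?addn0 // => c ne_c.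
by rewrite eq_sym (negPf ne_c) andbF.
Qed.

Definition L_free (T : Type) (n : nat) (f : nat -> nat -> T) : Prop :=
  forall x y d, 0 < d -> x + d < n -> y + d < n ->
    f x y = f (x + d) y -> f (x + d) (y + d) <> f x y.

Lemma third_color (T : finType) (a b x y : T) : #|T| = 3 -> a != b ->
  x != a -> x != b -> y != a -> y != b -> x = y.
Proof.
move=> cardT ab xa xb ya yb; apply: contraTeq (leqnn #|T|) => xy.
rewrite -ltnNge [ltnLHS]cardT.
apply: leq_trans (max_card (mem [:: a; b; x; y])).
rewrite (card_uniqP _) //= !inE !negb_or ab xy.
by rewrite (eq_sym a x) (eq_sym a y) (eq_sym b x) (eq_sym b y) xa xb ya yb.
Qed.

Section ThreeColors.

Variables (T : finType) (n : nat) (f : nat -> nat -> T).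
Hypotheses (cardT : #|T| = 3) (Lf : L_free n f).

Definition diag_pair (c : T) (d i : nat) : bool :=
  (f i i == c) && (f (i + d) (i + d) == c).

(** The set Q of the overview, with [c] and [c'] as colors 1 and 2. *)
Definition diag_pair_below (c c' : T) (d i : nat) : bool :=
  diag_pair c d i && (f (i + d) i == c').

Lemma diag_color_off (c : T) (a b : nat) :
  a < b < n -> f a a = c -> f b b = c -> f b a != c.
Proof.
move=> /andP[ab bn] fa fb; apply/eqP => fba.
have := @Lf a a (b - a); rewrite subn_gt0 subnKC ?(ltnW ab) // fa fba fb.
by move=> /(_ ab bn bn erefl).
Qed.

(** Color [c] would complete an L with [(a, a)] and [(b + d, b + d)], color [c'] one with
    [(a + d, a)] and [(b + d, b)]. *)
Lemma corner_color (c c' : T) (d a b : nat) : a < b -> b + d < n ->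
  diag_pair_below c c' d a -> diag_pair_below c c' d b ->
  (f (b + d) a != c) && (f (b + d) a != c').
Proof.
move=> ab bdn /andP[/andP[/eqP fa _] /eqP fda].
move=> /andP[/andP[_ /eqP fbd] /eqP fdb].
apply/andP; split; first by apply: diag_color_off => //; lia.
apply/eqP => fba; have := @Lf (a + d) a (b - a).
rewrite addnAC subnKC ?(ltnW ab) // subn_gt0 fda fba fdb.
by move=> /(_ ab bdn (leq_ltn_trans (leq_addr d b) bdn) erefl).
Qed.

Lemma bin_diag_pair_below (c c' : T) (d : nat) : c != c' ->
  'C(\sum_(0 <= i < n - d) diag_pair_below c c' d i, 2) <= (n - d).-1.
Proof.
move=> ne_cc'; rewrite -sum_pairs_by_difference.
apply: (@leq_trans (\sum_(1 <= e < n - d) 1)); last first.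
  by rewrite sum_nat_const_nat muln1 subn1.
rewrite big_nat_cond [leqRHS]big_nat_cond; apply: leq_sum => e.
rewrite andbT => /andP[e_gt0 e_lt]; apply: sum_pred_le1 => i j /andP[ij j_lt].
have [jd jed ije iej] : [/\ j + d < n, j + e + d < n, i < j + e & i + e < j + e].
  by split; lia.
move=> /andP[Qi Qie]; apply/negP => /andP[Qj Qje].
(* The three corners of an L of size [e]; each avoids [c] and [c']. *)
have /andP[c1 c1'] := corner_color ij jd Qi Qj.
have /andP[c2 c2'] := corner_color ije jed Qi Qje.
have /andP[c3 c3'] := corner_color iej jed Qie Qje.
have := @Lf (j + d) i e e_gt0; rewrite addnAC; apply => //.
- by apply: ltn_trans iej (leq_ltn_trans (leq_addr d _) jed).
- exact: third_color ne_cc' _ _ _ _.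
- exact: third_color ne_cc' _ _ _ _.
Qed.

(* (u - k)(u - k - 1) >= 0 bounds u linearly in terms of 'C(u, 2). *)
Lemma linear_le_bin2 (k u : nat) : k * u.*2 <= 'C(u, 2).*2 + k * k.+1.
Proof.
have -> : 'C(u, 2).*2 = u * u.-1.
  by rewrite bin2 halfK oddM; case: u => //= u; case: (odd u); rewrite subn0.
by case: u => [|u] /=; [lia | case: (leqP k u) => ku; nia].
Qed.

Lemma sum_diag_pair_le (k d : nat) (c : T) : 0 < d ->
  k * \sum_(0 <= i < n - d) diag_pair c d i <= (n - d).-1.*2 + k * k.+1.
Proof.
move=> d_gt0; rewrite (sum_color_classes (diag_pair c d) (fun i => f (i + d) i)).
(* The class of [c] itself is empty, since [(i + d, i)] would complete an L with two diagonal
   points. *)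
rewrite (bigD1 c) //= [X in X + _]big_nat_cond big1 ?add0n; last first.
  move=> i /andP[/andP[_ i_lt] _]; apply/eqP; rewrite eqb0 negb_and orbC -implybE.
  apply/implyP => /eqP fd; apply/negP => /andP[/eqP fi /eqP fid].
  have ltid : i < i + d < n by lia.
  by have := diag_color_off ltid fi fid; rewrite fd eqxx.
(* After doubling, each of the two other colors has to contribute at most the original right-hand
   side. *)
rewrite -leq_double doubleMr -mul2n !big_distrr /=.
apply: (@leq_trans (\sum_(c' | c' != c) ((n - d).-1.*2 + k * k.+1))).
  apply: leq_sum => c' ne_c'; rewrite mul2n.
  apply: leq_trans (linear_le_bin2 _ _) _.
  by rewrite leq_add2r leq_double bin_diag_pair_below // eq_sym.
rewrite sum_nat_const (_ : #|_| = 2) ?mul2n //.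
by have := cardC1 c; rewrite cardT.
Qed.

(** Using one [k] for all [d] replaces a sum of square roots by an arithmetic progression. *)
Lemma bin_diag_color (k : nat) (c : T) :
  k * 'C(\sum_(0 <= i < n) (f i i == c), 2) <= n.-1 * n.-2 + n.-1 * (k * k.+1).
Proof.
rewrite -(sum_pairs_by_difference (fun i => f i i == c)) big_distrr /=.
apply: (@leq_trans (\sum_(1 <= d < n) ((n - d).-1.*2 + k * k.+1))).
  rewrite big_nat_cond [leqRHS]big_nat_cond; apply: leq_sum => d.
  by rewrite andbT => /andP[d_gt0 _]; apply: sum_diag_pair_le.
rewrite big_split /= sum_nat_const_nat subn1 leq_add2r.
case: (n) => [|m]; first by rewrite big_geq.
rewrite big_add1 /= big_nat_rev /=.
rewrite (eq_big_nat _ _ (F2 := fun i => 2 * i)); last first.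
  by move=> i /andP[_ i_lt]; lia.
by rewrite -big_distrr /= mul2n bin2_sum bin2 halfK leq_subr.
Qed.

End ThreeColors.

Lemma no_L_free_1573 (T : finType) (f : nat -> nat -> T) :
  #|T| = 3 -> ~ L_free 1573 f.
Proof.
move=> cardT Lf.
(* Pigeonhole: 3 * 524 = 1572 < 1573. *)
have [c c_big] : exists c, 524 < \sum_(0 <= i < 1573) (f i i == c).
  apply/existsP; apply: contraT; rewrite negb_exists => /forallP small.
  have := sum_color_classes predT (fun i => f i i) 1573.
  rewrite sum_nat_const_nat /= => sumE.
  have : \sum_(c : T) \sum_(0 <= i < 1573) (f i i == c) <= \sum_(c : T) 524.
    by apply: leq_sum => c _; rewrite leqNgt.
  by rewrite -sumE sum_nat_const cardT; lia.
(* k = 40, close to the square root of 1573, minimizes the bound. *)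
have := bin_diag_color cardT Lf 40 c.
have : 'C(525, 2) <= 'C(\sum_(0 <= i < 1573) (f i i == c), 2) by apply: leq_bin2l.
(* The contradiction is 40 * 137550 = 5502000 > 5047692 = 1572 * (1571 + 1640). *)
by rewrite bin2; lia.
Qed.

Lemma forces_L_1573 : forces_L 3 1573.
Proof.
move=> c; apply: NNPP => noL.
(* Beyond the grid [inord] gives a default index, but [L_free 1573] only looks at indices below
   1573. *)
pose f (x y : nat) := c (inord x : 'I_1573, inord y : 'I_1573).
apply: (@no_L_free_1573 _ f); first exact: card_ord.
move=> x y d d_gt0 xd yd f1 f2; apply: noL.
exists [set (inord x, inord y); (inord (x + d), inord y);
            (inord (x + d), inord (y + d))].
  exists d, (inord x), (inord y), (inord (x + d)), (inord (y + d)).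
  by split=> //; rewrite !inordK //; lia.
suff fS p : p \in [set (inord x, inord y); (inord (x + d), inord y);
    (inord (x + d), inord (y + d))] -> c p = f x y.
  by move=> p q /fS -> /fS ->.
by rewrite !inE => /orP[/orP[]|] /eqP ->.
Qed.

(** [forces_L] is a mere proposition, so the least element is found by strong induction and excluded
    middle. *)
Lemma is_RL_le (k n : nat) : 0 < n -> forces_L k n ->
  exists2 m, is_RL k m & m <= n.
Proof.
elim/ltn_ind: n => n IHn n_gt0 Fn.
case: (classic (exists2 m, m < n & 0 < m /\ forces_L k m)) => [|min_n].
  move=> [m mn [m_gt0 Fm]]; have [r RLr rm] := IHn m mn m_gt0 Fm.
  by exists r => //; apply: leq_trans rm (ltnW mn).
exists n => //; split=> // m m_gt0 Fm; rewrite leqNgt; apply/negP => mn.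
by apply: min_n; exists m.
Qed.

Theorem theorem4 : exists2 n : nat, is_RL 3 n & n <= 1573.
Proof. exact: is_RL_le forces_L_1573. Qed.
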